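(* Let $\mathbf p\in\mathbb N^m$, $\mathbf q\in\mathbb N^n$, and let $\mathbf r=\bar{\mathbf q}$ be the vector of counts of $\mathbf q$. The numbers of matrices with margins $(\mathbf p,\mathbf q)$ satisfy: (1) (binary matrices) $$\bar N(\mathbf p,\mathbf r)=\sum_{\mathbf s\in C^{\mathbf r}(p_1)}\binom{\mathbf r}{\mathbf s}\,\bar N(L\mathbf p,\ \mathbf r\backslash\mathbf s);$$ (2) ($\mathbb N$-valued matrices) $$\bar M(\mathbf p,\mathbf r)=\sum_{\mathbf s\,:\,\mathbf s\in C^{\mathbf r+L\mathbf s}(p_1)}\binom{\mathbf r+L\mathbf s}{\mathbf s}\,\bar M(L\mathbf p,\ \mathbf r\backslash\mathbf s),$$ where the sum is over all $\mathbf s$ such that $\mathbf s\in C^{\mathbf r+L\mathbf s}(p_1)$.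
   Context: $\mathbb N=\{0,1,2,\dots\}$. $\mathbb N^n$ is regarded as the subset of $\mathbb N^\infty=\{(r_1,r_2,\dots):r_i\in\mathbb N\}$ of sequences in which all but the first $n$ components are zero. $L$ is the left shift: $L(r_1,r_2,r_3,\dots)=(r_2,r_3,\dots)$. For finitely supported vectors, $\mathbf r\backslash\mathbf s:=\mathbf r-\mathbf s+L\mathbf s$, $\binom{\mathbf r}{\mathbf s}:=\prod_i\binom{r_i}{s_i}$, and $\mathbf r\le\mathbf s$ means $r_i\le s_i$ for all $i$. The vector of counts of $\mathbf r\in\mathbb N^n$ is $\bar{\mathbf r}=(\bar r_1,\bar r_2,\dots)$ with $\bar r_i=\#\{j:r_j=i\}$ for $i\ge1$. $C_n(k)=\{\mathbf r\in\mathbb N^n:\sum_i r_i=k\}$, and for $\mathbf s\in\mathbb N^n$, $C^{\mathbf s}(k)=\{\mathbf r\in C_n(k):\mathbf r\le\mathbf s\}$ (this does not depend on the choice of $n$ with $\mathbf s\in\mathbb N^n$). For $(\mathbf p,\mathbf q)\in\mathbb N^m\times\mathbb N^n$, $N(\mathbf p,\mathbf q)$ (resp. $M(\mathbf p,\mathbf q)$) is the number of $m\times n$ matrices with entries in $\{0,1\}$ (resp. in $\mathbb N$) whose $i$-th row sum is $p_i$ and $j$-th column sum is $q_j$ for all $1\le i\le m$, $1\le j\le n$. These numbers are unchanged by permuting the $p_i$ or the $q_j$ and by inserting or deleting zero margins, so one may define unambiguously $\bar N(\mathbf p,\bar{\mathbf q}):=N(\mathbf p,\mathbf q)$ and $\bar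 M(\mathbf p,\bar{\mathbf q}):=M(\mathbf p,\mathbf q)$; thus for any finitely supported $\mathbf t$ with entries in $\mathbb N$, $\bar N(\mathbf p,\mathbf t)=N(\mathbf p,\mathbf v)$ and $\bar M(\mathbf p,\mathbf t)=M(\mathbf p,\mathbf v)$ for any $\mathbf v$ with $\bar{\mathbf v}=\mathbf t$. *)

(* Defs.v *)
From mathcomp Require Import all_boot all_algebra finmap.
From mathcomp Require Import perm.
From mathcomp Require Import boolp classical_sets functions cardinality fsbigop.

Set Implicit Arguments.
Unset Strict Implicit.
Unset Printing Implicit Defensive.

Local Open Scope classical_set_scope.

(* Sequences are indexed from 0: r i is the component r_(i+1) of (r_1, r_2,   *)
(* ...).                                                                      *)
Definition vec := nat -> nat.

Definition Nvec (n : nat) : set vec := [set r | forall i, n <= i -> r i = 0].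

Definition vec_shift (r : vec) : vec := fun i => r i.+1.

Definition vec_add (r s : vec) : vec := fun i => r i + s i.

Definition vec_le (r s : vec) : Prop := forall i, r i <= s i.

(* r \ s = r - s + L s. The truncated subtraction is done last: for N-valued  *)
(* matrices only s <= r + L s holds, not s <= r.                              *)
Definition vec_backslash (r s : vec) : vec := fun i => vec_add r (vec_shift s) i - s i.

(* All but finitely many factors are 'C(0, 0) = 1 when r and s have finite    *)
(* support.                                                                   *)
Definition vec_binom (r s : vec) : nat :=
  \big[muln/1]_(i \in [set: nat]) 'C(r i, s i).

(* Index i stands for the value i.+1: zeros are not counted.                  *)
Definition counts (r : vec) : vec :=
  fun i => #|` fset_set [set j | r j = i.+1] |.

Definition wcomp (n k : nat) : set vec :=
  [set r | Nvec n r /\ \sum_(i < n) r i = k].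

Definition wcomp_le (s : vec) (k : nat) : set vec :=
  [set r | exists n, [/\ Nvec n s, wcomp n k r & vec_le r s]].

Definition margin_mx (E : set nat) (m n : nat) (p q : vec) :
    set 'M[nat]_(m, n) :=
  [set A | [/\ forall i j, E (A i j),
               forall i : 'I_m, \sum_(j < n) A i j = p i
             & forall j : 'I_n, \sum_(i < m) A i j = q j]].

Definition num_mx (E : set nat) (m n : nat) (p q : vec) : nat :=
  #|` fset_set (@margin_mx E m n p q) |.

Definition numN : nat -> nat -> vec -> vec -> nat := num_mx [set 0; 1].
Definition numM : nat -> nat -> vec -> vec -> nat := num_mx [set: nat].

(* The pair (n, v) is an arbitrary one with v in N^n and vector of counts t;  *)
(* by num_bar_counts the value does not depend on it, and by counts_surj it   *)
(* exists when t has finite support.                                          *)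
Definition num_bar (num : nat -> nat -> vec -> vec -> nat) (m : nat)
    (p t : vec) : nat :=
  let nv := xget (0, fun=> 0)
              [set nv : nat * vec | Nvec nv.1 nv.2 /\ counts nv.2 = t] in
  num m nv.1 p nv.2.

Definition barN : nat -> vec -> vec -> nat := num_bar numN.
Definition barM : nat -> vec -> vec -> nat := num_bar numM.

Lemma margin_mx_finite E m n p q : finite_set (@margin_mx E m n p q).
Proof.
pose K := \sum_(i < m) p i.
pose f (B : 'M['I_K.+1]_(m, n)) : 'M[nat]_(m, n) := map_mx val B.
apply: (@sub_finite_set _ _ (f @` setT)); last first.
  by apply: finite_image; exact: finite_finset.
move=> A [_ Ap _]; exists (map_mx inord A) => //.
apply/matrixP => i j; rewrite !mxE /= inordK // ltnS.
apply: (@leq_trans (p i)); first by rewrite -Ap (bigD1 j) //= leq_addr.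
by rewrite /K (bigD1 i) //= leq_addr.
Qed.

Lemma card_fset_set_image (T U : choiceType) (f : T -> U) (A : set T) :
  finite_set A -> {in A &, injective f} ->
  #|` fset_set (f @` A)| = #|` fset_set A|.
Proof.
move=> Af fi; rewrite fset_set_image // card_in_imfset //= => x y.
by rewrite !in_fset_set //; exact: fi.
Qed.

Lemma num_mx_pad (E : set nat) m n k p q : E 0 -> Nvec n q ->
  num_mx E m (n + k) p q = num_mx E m n p q.
Proof.
move=> E0 qn; pose f (A : 'M[nat]_(m, n)) : 'M[nat]_(m, n + k) := row_mx A 0%R.
have f_inj : {in margin_mx E p q &, injective f}.
  by move=> A B _ _ /eq_row_mx[].
rewrite /num_mx -(card_fset_set_image (margin_mx_finite _ _ _ _ _) f_inj).
congr (#|` fset_set _ |); apply/seteqP; split => [A [AE Ap Aq]|_ [A [AE Ap Aq] <-]].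
- have A0 i (j : 'I_k) : A i (rshift n j) = 0.
    have /eqP := Aq (rshift n j); rewrite qn ?leq_addr // sum_nat_eq0.
    by move=> /forallP /(_ i) /eqP.
  exists (lsubmx A); last first.
    rewrite /f -[RHS]hsubmxK; congr row_mx.
    by apply/matrixP => i j; rewrite !mxE A0.
  split=> [i j|i|j]; first by rewrite mxE.
  + rewrite -Ap big_split_ord /= [X in _ + X]big1 ?addn0 => [|j _]; last by rewrite A0.
    by apply: eq_bigr => j _; rewrite mxE.
  + by rewrite -(Aq (lshift k j)); apply: eq_bigr => i _; rewrite mxE.
- split=> [i j|i|j].
  + by case: (split_ordP j) => j' ->; rewrite ?row_mxEl ?row_mxEr // mxE.
  + rewrite big_split_ord /= [X in _ + X]big1 ?addn0 => [|j _]; last first.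
      by rewrite row_mxEr mxE.
    by rewrite -Ap; apply: eq_bigr => j _; rewrite row_mxEl.
  + case: (split_ordP j) => j' ->.
      by rewrite -(Aq j'); apply: eq_bigr => i _; rewrite row_mxEl.
    by rewrite qn ?leq_addr // big1 // => i _; rewrite row_mxEr mxE.
Qed.

Lemma num_mx_perm (E : set nat) m n p (q q' : vec) (s : 'S_n) :
  (forall j : 'I_n, q' j = q (s j)) ->
  num_mx E m n p q' = num_mx E m n p q.
Proof.
have s_inj : {in margin_mx E p q &, injective (@col_perm nat m n s)}.
  by move=> A B _ _ /matrixP AB; apply/matrixP => i j;
    have := AB i (s^-1%g j); rewrite !mxE permKV.
move=> qs.
rewrite /num_mx -(card_fset_set_image (margin_mx_finite _ _ _ _ _) s_inj).
congr (#|` fset_set _ |); apply/seteqP.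
split => [A [AE Ap Aq]|_ [A [AE Ap Aq] <-]].
  + exists (col_perm s^-1%g A); last first.
      by apply/matrixP => i j; rewrite !mxE permK.
    split=> [i j|i|j]; first by rewrite mxE.
    * rewrite -Ap [RHS](reindex_inj (@perm_inj _ s^-1%g)) /=.
      by apply: eq_bigr => j _; rewrite mxE.
    * rewrite -{2}(permKV s j) -qs -Aq.
      by apply: eq_bigr => i _; rewrite mxE.
  + split=> [i j|i|j]; first by rewrite mxE.
    * rewrite -Ap [RHS](reindex_inj (@perm_inj _ s)) /=.
      by apply: eq_bigr => j _; rewrite mxE.
    * by rewrite qs -Aq; apply: eq_bigr => i _; rewrite mxE.
Qed.

Lemma countsE n r i : Nvec n r ->
  counts r i = count_mem i.+1 [seq r j | j <- iota 0 n].
Proof.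
move=> rn; rewrite /counts count_map -size_filter -(undup_id (filter_uniq _ (iota_uniq _ _))).
rewrite -card_fseq; congr (#|` _ |); apply/fsetP => j.
have fin : finite_set [set j | r j = i.+1].
  apply: (@sub_finite_set _ _ `I_n) => [k /= rk|]; last exact: finite_II.
  by rewrite ltnNge; apply/negP => /rn; rewrite rk.
rewrite in_fset_set // !inE mem_filter mem_iota /= add0n.
apply/asboolP/andP => [rj|[/eqP]//]; split; first exact/eqP.
by rewrite ltnNge; apply/negP => /rn; rewrite rj.
Qed.

Lemma num_mx_counts (E : set nat) m n n' p v v' : E 0 -> Nvec n v ->
  Nvec n' v' -> counts v = counts v' -> num_mx E m n p v = num_mx E m n' p v'.
Proof.
move=> E0 vn vn' vv'.
rewrite -(num_mx_pad m n' p E0 vn) -(num_mx_pad m n p E0 vn') [(n' + n)%N]addnC.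
have {}vn : Nvec (n + n') v by move=> i /(leq_trans (leq_addr _ _))/vn.
have {}vn' : Nvec (n + n') v' by move=> i /(leq_trans (leq_addl _ _))/vn'.
move: (n + n')%N vn vn' => K vK vK'.
have mapE (u : vec) : [seq u j | j <- iota 0 K] = [tuple u j | j < K].
  by rewrite /= -val_enum_ord -map_comp.
have cnt k : count_mem k.+1 [seq v j | j <- iota 0 K]
           = count_mem k.+1 [seq v' j | j <- iota 0 K].
  by rewrite -!countsE // vv'.
have : perm_eq [seq v j | j <- iota 0 K] [seq v' j | j <- iota 0 K].
  set s := map _ _ in cnt *; set s' := map v' _ in cnt *.
  have ps : perm_eq (filter (predC1 0) s) (filter (predC1 0) s').
    apply/allP => -[|k] _ /=; apply/eqP.
      have e : predI (pred1 0) (predC1 0) =1 pred0 by case.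
      by rewrite !count_filter !(eq_count e) !count_pred0.
    rewrite !count_filter.
    have e : predI (pred1 k.+1) (predC1 0) =1 pred1 k.+1.
      by move=> [|x]; rewrite /= ?andbF ?andbT.
    by rewrite !(eq_count e) cnt.
  have sz : count_mem 0 s = count_mem 0 s'.
    have h1 := count_predC (pred1 0) s; have h2 := count_predC (pred1 0) s'.
    have h3 := perm_size ps; rewrite !size_filter in h3.
    have h4 : size s = size s' by rewrite !size_map.
    apply/eqP; rewrite -(eqn_add2r (count (predC (pred1 0)) s)).
    rewrite h1 h4 -h2 eqn_add2l; apply/eqP; symmetry; exact: h3.
  apply/allP => -[|k] _ /=; apply/eqP; [exact: sz | exact: cnt].
rewrite !mapE => /tuple_permP [s /val_inj es].
apply: (@num_mx_perm E m K p v' v s) => j.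
by have := congr1 (fun t => tnth t j) es; rewrite !tnth_mktuple.
Qed.

Lemma num_bar_counts (E : set nat) m n p t v : E 0 -> Nvec n v ->
  counts v = t -> num_bar (num_mx E) m p t = num_mx E m n p v.
Proof.
move=> E0 vn vt; rewrite /num_bar; case: xgetP => [[n' v'] _ [/= vn' vt']|].
  by apply: num_mx_counts; rewrite // vt.
by move=> /(_ (n, v))[].
Qed.

Lemma counts_surj k t : Nvec k t -> exists n v, Nvec n v /\ counts v = t.
Proof.
move=> tk; pose s := flatten [seq nseq (t i) i.+1 | i <- iota 0 k].
have sn : Nvec (size s) (nth 0 s) by move=> i; exact: nth_default.
exists (size s), (nth 0 s); split=> //; apply/funext => i.
rewrite (countsE _ sn) -/(mkseq _ _) mkseq_nth count_flatten -map_comp sumnE big_map.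
under eq_bigr do rewrite /= count_nseq /= eqSS.
have [ki|ik] := leqP k i.
  rewrite tk // big_seq big1 // => j; rewrite mem_iota add0n => /andP[_ jk].
  by rewrite eqn_leq [i <= j]leqNgt (leq_trans jk ki) andbF.
rewrite (bigD1_seq i) ?iota_uniq ?mem_iota //= eqxx mul1n big1 ?addn0 // => j.
by move=> /negbTE ->.
Qed.

(* Main.v *)
Require Import Defs.
From mathcomp Require Import all_boot all_algebra finmap zify.
From mathcomp Require Import boolp classical_sets functions cardinality fsbigop.

Set Implicit Arguments.
Unset Strict Implicit.
Unset Printing Implicit Defensive.

(* Deleting the first row of a matrix lowers the column sums from q to some   *)
(* t <= q (with q <= t + 1 in the binary case). With s_i the number of        *)
(* columns j such that t_j < i <= q_j, the vector of counts of t is           *)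
(* r - s + L s = r \ s, and s has sum p_1. So it remains to count the t with  *)
(* a given s. Lowering each column through its levels from the top, s_i       *)
(* columns must be chosen to leave level i, among the r_i columns that start  *)
(* there and, except in the binary case, the s_(i+1) columns that come from   *)
(* level i + 1: there are 'C(r_i + s_(i+1), s_i), resp. 'C(r_i, s_i), choices *)
(* at level i.                                                                *)

(** Both identities are one recursion, [num_bar_recursion], read for [c = true] and for [c = false].
    [num_mx_first_row] writes the number of matrices as a sum over the column sums [t] left once the
    first row is deleted. By [counts_crossings] the counts of [t] depend on [t] only through its
    crossing vector [s], so all [t] with the same [s] contribute the same number, and
    [sum_crossings] gives [s] the sum [p 0]. How many [t] share [s] is the product of binomials in
    [card_residual], built up one level at a time by [card_residual_fibre]. *)

(* Levels are numbered from 0, as in counts: this is s_(i+1), and t is q minus *)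
(* the first row.                                                             *)
Definition crossings n (q t : 'I_n -> nat) (i : nat) : nat :=
  \sum_(j < n) (t j <= i < q j).

(* Here and below, c = true is the binary case, and c = false the N-valued    *)
(* one.                                                                       *)
Definition residual (c : bool) n (q t : 'I_n -> nat) : bool :=
  [forall j, (t j <= q j) && (c ==> (q j <= (t j).+1))].

(** * Residual column sums with given crossings *)

(** Given [t'], the value [t j] is forced except on the set [D] of columns where both 0 and 1 are
    allowed; choosing [t] means choosing which [k] columns of [D] drop to 0. *)
Lemma card_residual_fibre (c : bool) n K (q : 'I_n -> nat)
    (t' : {ffun 'I_n -> 'I_K.+1}) k :
  (forall j, q j <= K) ->
  residual c (fun j => (q j).-1) (fun j => t' j) ->
  #|[set t : {ffun 'I_n -> 'I_K.+1} | [&& residual c q (fun j => t j),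
       [forall j, (t j).-1 == t' j :> nat] & crossings q (fun j => t j) 0 == k]]|
  = 'C(\sum_(j < n) (q j == 1) +
       ~~ c * crossings (fun j => (q j).-1) (fun j => t' j) 0, k).
Proof.
move=> qK /forallP rt'.
pose D := [set j | [&& t' j == 0 :> nat, 0 < q j & c ==> (q j <= 1)]].
have -> : \sum_(j < n) (q j == 1) +
    ~~ c * crossings (fun j => (q j).-1) (fun j => t' j) 0 = #|D|.
  rewrite -sum1_card [RHS]big_mkcond /crossings big_distrr -big_split /=.
  apply: eq_bigr => j _; rewrite inE.
  by have := rt' j; case: (c) => /=; case: ifP; lia.
rewrite -cards_draws.
pose Z (t : {ffun 'I_n -> 'I_K.+1}) := [set j | (t j == 0 :> nat) && (0 < q j)].
have cardZ (t : {ffun 'I_n -> 'I_K.+1}) : crossings q (fun j => t j) 0 = #|Z t|.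
  rewrite -sum1_card [RHS]big_mkcond; apply: eq_bigr => j _.
  by rewrite inE; case: ifP; lia.
rewrite -(card_in_imset (f := Z)) => [|t u]; last first.
  rewrite !inE => /and3P[/forallP tq /forallP tt' _] /and3P[/forallP uq /forallP ut' _].
  move=> /setP ZZ; apply/ffunP => j; apply/val_inj => /=.
  have := ZZ j; rewrite !inE.
  by have := tq j; have := uq j; have := tt' j; have := ut' j; lia.
congr #|pred_of_set _|; apply/setP => A; rewrite !inE; apply/imsetP/andP.
- case=> t; rewrite inE => /and3P[/forallP tq /forallP tt' tk ->]; split.
    apply/fintype.subsetP => j; rewrite !inE.
    by have := tq j; have := tt' j; case: (c); lia.
  by rewrite -cardZ.
- case=> /fintype.subsetP AD Ak.
  (* Outside [A], a column with [t' j = 0] gets 1, unless [q j = 0] keeps it at 0. *)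
  pose t := [ffun j => inord (if j \in A then 0
              else if t' j == 0 :> nat then (0 < q j : nat) else (t' j).+1) : 'I_K.+1].
  have tE j : t j = (if j \in A then 0
              else if t' j == 0 :> nat then (0 < q j : nat) else (t' j).+1) :> nat.
    rewrite ffunE inordK //.
    by have := rt' j; have := qK j; do 2 case: ifP => //; lia.
  have AE : A = Z t.
    apply/setP => j; rewrite inE tE.
    by have := AD j; rewrite inE; case: (j \in A) => [/(_ isT)|_]; [|case: ifP]; lia.
  exists t => //; rewrite inE cardZ -AE Ak andbT; apply/andP; split.
    apply/forallP => j; rewrite tE; have := rt' j.
    have := AD j; rewrite inE; case: (j \in A) => [/(_ isT)|_]; [|case: ifP]; case: (c); lia.
  apply/forallP => j; rewrite tE; have := rt' j.
  by have := AD j; rewrite inE; case: (j \in A) => [/(_ isT)|_]; [|case: ifP]; lia.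
Qed.

(* Induction on b through t |-> t.-1, which removes the lowest level.         *)
Lemma card_residual (c : bool) n K b (q : 'I_n -> nat) (s : vec) :
  (forall j, q j <= b) -> b <= K -> Nvec b s ->
  #|[set t : {ffun 'I_n -> 'I_K.+1} | residual c q (fun j => t j) &
       [forall i : 'I_b, crossings q (fun j => t j) i == s i]]|
  = \prod_(i < b) 'C(\sum_(j < n) (q j == i.+1) + ~~ c * s i.+1, s i).
Proof.
elim: b => [|b IHb] in q s * => qb bK sb.
  rewrite big_ord0; apply/eqP/cards1P; exists [ffun=> ord0]; apply/setP => t.
  rewrite !inE; apply/andP/eqP => [[/forallP tq _]|->].
    apply/ffunP => j; apply/val_inj; rewrite ffunE /=.
    by have := tq j; have := qb j; lia.
  split; last by apply/forallP; case.
  by apply/forallP => j; rewrite ffunE /=; have := qb j; lia.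
pose q' j := (q j).-1.
pose pt (t : {ffun 'I_n -> 'I_K.+1}) :=
  [ffun j => inord (t j).-1] : {ffun 'I_n -> 'I_K.+1}.
have ptE (t : {ffun 'I_n -> 'I_K.+1}) j : pt t j = (t j).-1 :> nat.
  by rewrite ffunE inordK //; have := ltn_ord (t j); lia.
pose Q (t : {ffun 'I_n -> 'I_K.+1}) := residual c q' (fun j => t j) &&
       [forall i : 'I_b, crossings q' (fun j => t j) i == s i.+1].
have cross_pt (t : {ffun 'I_n -> 'I_K.+1}) i :
    crossings q' (fun j => pt t j) i = crossings q (fun j => t j) i.+1.
  by apply: eq_bigr => j _; rewrite ptE /q'; lia.
rewrite -sum1dep_card (partition_big pt Q) /=; last first.
  move=> t /andP[/forallP tq /forallP ts]; apply/andP; split.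
    by apply/forallP => j; have := tq j; rewrite ptE /q'; case: (c); lia.
  by apply/forallP => i; have := ts (lift ord0 i); rewrite cross_pt lift0.
rewrite big_ord_recl.
under [X in _ = _ * X]eq_bigr => i _ do rewrite lift0.
have q'b j : q' j <= b by have := qb j; rewrite /q'; lia.
have := IHb q' (vec_shift s) q'b (ltnW bK); rewrite /vec_shift => IH.
have -> : \prod_(i < b) 'C(\sum_(j < n) (q j == i.+2) + ~~ c * s i.+2, s i.+1) =
   #|[set t : {ffun 'I_n -> 'I_K.+1} | Q t]|.
  rewrite IH => [|i bi]; last exact: sb.
  apply: eq_bigr => i _; congr 'C(_ + _, _); apply: eq_bigr => j _.
  by rewrite /q'; lia.
rewrite -sum1dep_card big_distrr /=; apply: eq_bigr => t' /andP[rt' /forallP st'].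
rewrite muln1 sum1dep_card.
(* For [b = 0] both sides vanish: [s 1] lies beyond the support and [q'] is zero. *)
have -> : s 1 = crossings q' (fun j => t' j) 0.
  have [b0|b0] := posnP b; last by have /eqP := st' (Ordinal b0).
  rewrite sb ?b0 // /crossings big1 // => j _.
  by have := q'b j; lia.
rewrite -card_residual_fibre //; last by move=> j; exact: leq_trans (qb j) bK.
apply: eq_card => t; rewrite !inE -andbA; congr (_ && _).
have pE : (pt t == t') = [forall j, (t j).-1 == t' j :> nat].
  apply/eqP/forallP => [<- j|tt']; first by rewrite ptE.
  by apply/ffunP => j; apply/val_inj; rewrite /= ptE; exact/eqP.
(* Over [t'] only level 0 is left to prescribe; the higher crossings are those of [t']. *)
rewrite -pE andbC; case: eqP => //= ptt'; apply/forallP/idP => [/(_ ord0)//|t0 i].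
case: (unliftP ord0 i) => [i' ->|->]; last exact: t0.
by rewrite lift0 -cross_pt ptt'.
Qed.

(** * Finite forms of products, counts and sums *)

Lemma vec_binom_ord b u s : Nvec b s ->
  vec_binom u s = \prod_(i < b) 'C(u i, s i).
Proof.
move=> sb; rewrite (fsbig_ord _ _ (fun i => 'C(u i, s i))); symmetry.
apply: fsbig_widen => // i [_ /= ib].
by rewrite sb ?bin0 // leqNgt; exact/negP.
Qed.

Lemma counts_ord n v i : Nvec n v -> counts v i = \sum_(j < n) (v j == i.+1).
Proof.
move=> vn; rewrite (countsE _ vn) -sum1_count big_map big_mkcond.
have -> : iota 0 n = index_iota 0 n by rewrite /index_iota subn0.
by rewrite big_mkord; apply: eq_bigr => j _; rewrite /=; case: (v j == _).
Qed.

(** Groups the sum by the value of [f], later the crossing vector; points of [S] that [f] misses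
    contribute 0. *)
Lemma sum_fsbig_fibre (T : finType) (I : choiceType) (P : pred T) (f : T -> I)
    (S : set I) (H : I -> nat) :
  finite_set S -> (forall t, P t -> S (f t)) ->
  \sum_(t | P t) H (f t) =
  \big[addn/0]_(s \in S) (#|[set t | P t & f t == s]| * H s).
Proof.
move=> finS PS; rewrite fsbig_finite //=.
under [RHS]eq_bigr => s _ do rewrite -sum_nat_const.
rewrite (exchange_big_dep P) /= => [|s t _]; last by rewrite inE => /andP[].
apply: eq_bigr => t Pt; rewrite -big_filter.
rewrite (eq_filter (a2 := pred1 (f t))) => [|s]; last by rewrite /= inE Pt eq_sym.
by rewrite filter_pred1_uniq ?big_seq1 ?fset_uniq // in_fset_set // inE; exact: PS.
Qed.

(** * Deletion of the first row *)

Definition entries (c : bool) : set nat := if c then [set 0; 1]%classic else setT.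

Definition zero_ext n (f : 'I_n -> nat) : vec := fun j => oapp f 0 (insub j).

Lemma zero_ext_ord n (f : 'I_n -> nat) (j : 'I_n) : zero_ext f j = f j.
Proof. by rewrite /zero_ext valK. Qed.

Lemma Nvec_zero_ext n (f : 'I_n -> nat) : Nvec n (zero_ext f).
Proof. by move=> i ni; rewrite /zero_ext insubF // ltnNge ni. Qed.

Lemma entries_residual c n (q t : 'I_n -> nat) : residual c q t <->
  forall j, t j <= q j /\ entries c (q j - t j).
Proof.
split=> [/forallP qt j|qt].
  have /andP[tq qt1] := qt j; split => //.
  case: c qt1 {qt} => //= qt1.
  have : q j - t j = 0 \/ q j - t j = 1 by lia.
  by case=> ->; [left|right].
apply/forallP => j; have [-> /=] := qt j.
by case: c {qt} => //= -[]; lia.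
Qed.

(** The column sums [t] of the remaining rows determine the first row as [q - t], so matrices with a
    given [t] correspond to their lower blocks. *)
Lemma num_mx_first_row (c : bool) m n K p (q : vec) :
  (forall j : 'I_n, q j <= K) ->
  num_mx (entries c) m.+1 n p q =
  \sum_(t : {ffun 'I_n -> 'I_K.+1} |
      residual c (fun j : 'I_n => q j) (fun j => t j) &&
      (\sum_(j < n) (q j - t j) == p 0))
     num_mx (entries c) m n (vec_shift p) (zero_ext (fun j => t j)).
Proof.
move=> qK.
pose g (A : 'M[nat]_(m.+1, n)) :=
  [ffun j : 'I_n => inord (q j - A ord0 j)] : {ffun 'I_n -> 'I_K.+1}.
have gE A (j : 'I_n) : g A j = q j - A ord0 j :> nat.
  by rewrite ffunE inordK //; have := qK j; lia.
rewrite {1}/num_mx; set X := fset_set _.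
have XP A : A \in X <-> margin_mx (entries c) p q A.
  by rewrite in_fset_set ?inE //; exact: margin_mx_finite.
have Aq A : A \in X -> forall j : 'I_n, A ord0 j <= q j.
  by move=> /XP[_ _ qA] j; rewrite -qA big_ord_recl leq_addr.
rewrite card_fset_sum1 big_seq.
pose Q (t : {ffun 'I_n -> 'I_K.+1}) :=
  residual c (fun j : 'I_n => q j) (fun j => t j) &&
  (\sum_(j < n) (q j - t j) == p 0).
rewrite (partition_big g Q) => [|A AX]; last first.
  have [EA pA _] := (XP A).1 AX; apply/andP; split.
    by apply/entries_residual => j; rewrite gE leq_subr subKn ?Aq.
  rewrite -(pA ord0); apply/eqP/eq_bigr => j _.
  by rewrite gE subKn ?Aq.
apply: eq_bigr => t /andP[/entries_residual tq /eqP tp].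
pose h (B : 'M[nat]_(m, n)) : 'M[nat]_(1 + m, n) := col_mx (\row_j (q j - t j)) B.
have h0 B j : h B ord0 j = q j - t j.
  have -> : ord0 = lshift m ord0 :> 'I_(1 + m) by exact/val_inj.
  by rewrite /h col_mxEu mxE.
have hS B i j : h B (lift ord0 i) j = B i j.
  have -> : lift ord0 i = rshift 1 i :> 'I_(1 + m) by exact/val_inj.
  by rewrite /h col_mxEd.
have h_inj :
    {in margin_mx (entries c) (vec_shift p) (zero_ext (fun j => t j)) &,
     injective h}.
  by move=> B B' _ _ /eq_col_mx[].
rewrite /num_mx -(card_fset_set_image (margin_mx_finite _ _ _ _ _) h_inj).
rewrite sum1_count -size_filter; apply/perm_size/uniq_perm.
- exact/filter_uniq/fset_uniq.
- exact: fset_uniq.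
move=> A; rewrite mem_filter andbAC andbb [RHS]in_fset_set; last first.
  by apply: finite_image; exact: margin_mx_finite.
rewrite [RHS]inE; apply/idP/asboolP.
- case/andP => AX /eqP gAt; have [EA pA qA] := (XP A).1 AX.
  exists (\matrix_(i, j) A (lift ord0 i) j)%R.
    split => [i j|i|j].
    + by rewrite mxE.
    + by rewrite /vec_shift -(pA (lift ord0 i)); apply: eq_bigr => j _; rewrite mxE.
    + rewrite zero_ext_ord -gAt gE -qA big_ord_recl addKn.
      by apply: eq_bigr => i _; rewrite mxE.
  apply/matrixP => i j; case: (unliftP ord0 i) => [i' ->|->]; first by rewrite hS mxE.
  by rewrite h0 -gAt gE subKn // Aq.
- case=> B [EB pB qB] <-.
  rewrite (_ : h B \in X); last first.
    apply/XP; split => [i j|i|j].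
    + case: (unliftP ord0 i) => [i' ->|->]; first by rewrite hS.
      by rewrite h0; have [] := tq j.
    + case: (unliftP ord0 i) => [i' ->|->].
        by rewrite lift0 -/(vec_shift p i') -pB; apply: eq_bigr => j _; rewrite hS.
      by rewrite -tp; apply: eq_bigr => j _; rewrite h0.
    + rewrite big_ord_recl h0.
      under eq_bigr do rewrite hS.
      by rewrite qB zero_ext_ord subnK //; have [] := tq j.
  apply/eqP/ffunP => j; apply/val_inj => /=.
  by rewrite gE h0 subKn //; have [] := tq j.
Qed.

(** * Crossings, counts and the range of summation *)

(** Both sides count the columns with [t j <= i.+1 <= q j], sorted on the left by whether they stop
    at that value, on the right by whether they start there. *)
Lemma counts_crossings (q t : vec) n i :
  (forall j : 'I_n, t j <= q j) ->
  \sum_(j < n) (t j == i.+1) + crossings (fun j : 'I_n => q j) (fun j => t j) i =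
  \sum_(j < n) (q j == i.+1) + crossings (fun j : 'I_n => q j) (fun j => t j) i.+1.
Proof.
by move=> tq; rewrite -!big_split; apply: eq_bigr => j _ /=; have := tq j; lia.
Qed.

(** Double counting: column [j] crosses [q j - t j] levels. *)
Lemma sum_crossings n b (q t : 'I_n -> nat) : (forall j, q j <= b) ->
  \sum_(i < b) crossings q t i = \sum_(j < n) (q j - t j).
Proof.
move=> qb; rewrite exchange_big; apply: eq_bigr => j _ /=.
move: (q j) (qb j); elim: b {qb} => [|b IHb] k kb; first by rewrite big_ord0; lia.
rewrite big_ord_recr /=; have [kb'|kb'] := leqP k b.
  by rewrite (IHb k) //; lia.
have -> : \sum_(i < b) (t j <= i < k) = \sum_(i < b) (t j <= i < b).
  by apply: eq_bigr => i _; have := ltn_ord i; lia.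
by rewrite IHb //; lia.
Qed.

(** The columns that may leave each level: in the binary case a column that has just come down one
    level must stop. *)
Definition available (c : bool) (r s : vec) : vec :=
  if c then r else vec_add r (vec_shift s).

Lemma sum_Nvec a b s : Nvec a s -> Nvec b s -> \sum_(i < a) s i = \sum_(i < b) s i.
Proof.
wlog ab : a b / a <= b => [hw|sa _].
  by have [|/ltnW] := leqP a b => /hw h sa sb; [|symmetry]; apply: h.
rewrite -(big_mkord xpredT s) -(big_mkord xpredT s) [RHS](big_cat_nat _ ab) //=.
by rewrite [X in _ + X]big_nat [X in _ + X]big1 ?addn0 // => i /andP[/sa].
Qed.

(** Replaces the existential bound in [wcomp_le] by the fixed [b], which makes the index set
    finite. *)
Lemma wcomp_le_availableP c b k r s : Nvec b r ->
  wcomp_le (available c r s) k s <->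
  [/\ Nvec b s, \sum_(i < b) s i = k & vec_le s (available c r s)].
Proof.
move=> rb; split=> [[n [_ [sn <-] sr]]|[sb <- sr]]; last first.
  exists b; split => // i bi; rewrite /available.
  by case: c {sr} => /=; rewrite ?/vec_add ?/vec_shift rb ?sb // leqW.
(* The bound n on the supports depends on s. Above level b, s is nondecreasing *)
(* and eventually zero, hence zero.                                           *)
suff sb : Nvec b s by split=> //; exact: sum_Nvec.
have sS i : b <= i -> s i <= s i.+1.
  by move=> bi; move: (sr i); rewrite /available /vec_add /vec_shift; case: (c); rewrite rb //; lia.
move=> i bi; have [ni|/ltnW lein] := leqP n i; first exact: sn.
have : s i <= s (i + (n - i)).
  elim: (n - i) => [|d IHd]; first by rewrite addn0.
  by apply: (leq_trans IHd); rewrite addnS; apply/sS/(leq_trans bi)/leq_addr.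
by rewrite subnKC // (sn n) // leqn0 => /eqP.
Qed.

Lemma finite_wcomp b k : finite_set (wcomp b k).
Proof.
pose f (t : {ffun 'I_b -> 'I_k.+1}) := zero_ext (fun j => t j).
apply: (@sub_finite_set _ _ (f @` setT)); last first.
  by apply: finite_image; exact: finite_finset.
move=> s [sb sk]; exists [ffun j : 'I_b => inord (s j)] => //; apply/funext => i.
have [bi|ib] := leqP b i; first by rewrite sb // /f Nvec_zero_ext.
rewrite /f (zero_ext_ord _ (Ordinal ib)) ffunE inordK // ltnS -sk.
by rewrite (bigD1 (Ordinal ib)) //= leq_addr.
Qed.

(** * The recursion *)

Lemma num_bar_recursion (c : bool) m n p q :
  Nvec m p -> Nvec n q ->
  num_bar (num_mx (entries c)) m p (counts q) =
    \big[addn/0]_(s \in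
        [set s | wcomp_le (available c (counts q) s) (p 0) s]%classic)
      (vec_binom (available c (counts q) s) s *
       num_bar (num_mx (entries c)) m.-1 (vec_shift p)
         (vec_backslash (counts q) s)).
Proof.
move=> pm qn; set r := counts q; set S := [set s | _]%classic.
have E0 : entries c 0 by case: (c); [left|].
pose b := \max_(j < n) q j.
have qb (j : 'I_n) : q j <= b by exact: leq_bigmax.
have rE i : r i = \sum_(j < n) (q j == i.+1) by exact: counts_ord.
have rb : Nvec b r.
  by move=> i bi; rewrite rE big1 // => j _; have := qb j; lia.
have SP s : S s <->
    [/\ Nvec b s, \sum_(i < b) s i = p 0 & vec_le s (available c r s)].
  exact: wcomp_le_availableP.
(* For [m = 0] also [m.-1 = 0], and [p 0 = 0] leaves only [s = 0]: both sides agree trivially. *)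
case: m pm => [|m] pm.
  have p0 i : p i = 0 by exact: pm.
  have -> : S = [set (fun=> 0)]%classic.
    apply/seteqP; split=> [s /SP[sb]|_ ->]; last first.
      by apply/SP; split=> //; rewrite p0 big1.
    rewrite p0 => /eqP; rewrite sum_nat_eq0 => /forallP s0 _; apply/funext => i.
    by have [/sb//|ib] := leqP b i; have /eqP := s0 (Ordinal ib).
  rewrite fsbig_set1 (@vec_binom_ord 0) // big_ord0 mul1n.
  congr num_bar; apply/funext => i; first by rewrite /vec_shift !p0.
  by rewrite /vec_backslash /vec_add addn0 subn0.
rewrite (num_bar_counts _ _ E0 qn erefl) (num_mx_first_row c m p qb) /=.
pose x (t : {ffun 'I_n -> 'I_b.+1}) : vec :=
  crossings (fun j : 'I_n => q j) (fun j => t j).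
have xb t : Nvec b (x t).
  by move=> i bi; rewrite /x /crossings big1 // => j _; have := qb j; lia.
have counts_x (t : {ffun 'I_n -> 'I_b.+1}) i : (forall j, t j <= q j) ->
    counts (zero_ext (fun j => t j)) i + x t i = r i + x t i.+1.
  move=> tq; have := @counts_crossings q (zero_ext (fun j => t j)) n i.
  rewrite (counts_ord _ (Nvec_zero_ext _)) rE.
  have xE k : crossings (fun j : 'I_n => q j)
      (fun j : 'I_n => zero_ext (fun j => t j) j) k = x t k.
    by apply: eq_bigr => j _; rewrite zero_ext_ord.
  by rewrite !xE => -> // j; rewrite zero_ext_ord.
(* Each summand becomes a function of [x t] alone. *)
under eq_bigr => t /andP[/forallP tq _].
  rewrite -(num_bar_counts m (vec_shift p) E0 (Nvec_zero_ext _) erefl).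
  rewrite (_ : counts _ = vec_backslash r (x t)); first by over.
  apply/funext => i; rewrite /vec_backslash /vec_add /vec_shift -counts_x ?addnK // => j.
  by have /andP[] := tq j.
rewrite (@sum_fsbig_fibre _ vec _ x S
  (fun s => num_bar (num_mx (entries c)) m (vec_shift p) (vec_backslash r s))).
- apply: eq_fsbigr => s /set_mem /SP[sb sp sr]; congr (_ * _).
  rewrite (vec_binom_ord _ sb).
  transitivity (\prod_(i < b)
    'C(\sum_(j < n) (q j == i.+1) + ~~ c * s i.+1, s i)); last first.
    apply: eq_bigr => i _; rewrite -rE /available.
    by case: (c); rewrite /= ?mul0n ?mul1n ?addn0.
  rewrite -(card_residual _ qb (leqnn b) sb); apply: eq_card => t; rewrite !inE -andbA.
  (* The row-sum condition is implied by [x t = s]. *)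
  congr (_ && _); apply/andP/forallP => [[_ /eqP <-] i|xs]; first exact: eqxx.
  have -> : x t = s.
    apply/funext => i; have [bi|ib] := leqP b i; first by rewrite sb // xb.
    by have /eqP := xs (Ordinal ib).
  split=> //; rewrite -(sum_crossings _ qb) -sp; apply/eqP/eq_bigr => i _.
  exact/eqP.
- apply: (@sub_finite_set _ _ (wcomp b (p 0))); last exact: finite_wcomp.
  by move=> s /SP[].
- move=> t /andP[/forallP tq /eqP tp]; apply/SP; split; first exact: xb.
    by rewrite -tp -(sum_crossings _ qb).
  move=> i; have tq' j : t j <= q j by have /andP[] := tq j.
  have := counts_x t i tq'; rewrite /available; case c1: (c); last first.
    by rewrite /vec_add /vec_shift => <-; exact: leq_addl.
  (* In the binary case [t j <= i < q j <= (t j).+1] forces [q j = i.+1]. *)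
  move=> _; rewrite rE; apply: leq_sum => j _.
  by have := tq j; rewrite c1; lia.
Qed.

Theorem theorem2p1 (m n : nat) (p q r : vec)
    (hp : Nvec m p) (hq : Nvec n q) (hr : r = counts q) :
  barN m p r =
    \big[addn/0%N]_(s \in wcomp_le r (p 0%N))
      (vec_binom r s * barN m.-1 (vec_shift p) (vec_backslash r s))%N
  /\
  barM m p r =
    \big[addn/0%N]_(s \in [set s | wcomp_le (vec_add r (vec_shift s)) (p 0%N) s]%classic)
      (vec_binom (vec_add r (vec_shift s)) s * barM m.-1 (vec_shift p) (vec_backslash r s))%N.
Proof.
by rewrite hr; split; [exact: (num_bar_recursion true hp hq) |
                       exact: (num_bar_recursion false hp hq)].
Qed.
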